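(* Let $\mathsf{P}:\mathsf{Set}^{\mathrm{op}}\to\mathsf{Hey}$ be an implicative tripos. A strongly trackable object $(A,\alpha)$ of $\mathbf{Reg}_{\mathsf{P}}$ is regular projective in $\mathbf{Reg}_{\mathsf{P}}$ if and only if $\alpha$ is a supercompact ($\mathbf{SK_p}$) predicate.
   Context: Implicative algebras. An implicative algebra $\mathbb{A}=(\mathcal{A},\leq,\to,\Sigma)$ is a complete lattice $(\mathcal{A},\leq)$ with a binary operation $\to$ (associating to the right) such that (i) $a'\leq a$ and $b\leq b'$ imply $a\to b\leq a'\to b'$, and (ii) $a\to\bigwedge_{b\in B}b=\bigwedge_{b\in B}(a\to b)$ for all $a\in\mathcal{A}$, $B\subseteq\mathcal{A}$; together with a separator $\Sigma\subseteq\mathcal{A}$, i.e. a subset that is upward closed, contains $\bigwedge_{a,b}(a\to b\to a)$ and $\bigwedge_{a,b,c}((a\to b\to c)\to(a\to b)\to a\to c)$, and satisfies: $a\to b\in\Sigma$ and $a\in\Sigma$ imply $b\in\Sigma$. Define $a\times b:=\bigwedge_{x\in\mathcal{A}}((a\to(b\to x))\to x)$ and $\exists_{i\in I}c_i:=\bigwedge_{x\in\mathcal{A}}(\bigwedge_{i\in I}(c_i\to x)\to x)$. Implicative tripos (of $\mathbb{A}$). For a set $I$, $\mathsf{P}(I)$ is the posetal reflection of $\mathcal{A}^I$ preordered by: $\varphi\vdash\psi$ iff $\bigwedge_{i\in I}(\varphi(i)\to\psi(i))\in\Sigma$. It is a Heyting algebra with order written $\leq$ and meet $\wedge$ (represented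 by the pointwise $\times$). For $f:I\to X$, $\mathsf{P}_f:\mathsf{P}(X)\to\mathsf{P}(I)$ is precomposition with $f$; its left adjoint $\exists_f$ is represented by $(\exists_f\varphi)(x)=\exists_{i\in f^{-1}(x)}\varphi(i)$. For a set $X$ with diagonal $\Delta_X$, $\delta_X:=\exists_{\Delta_X}(\top)\in\mathsf{P}(X\times X)$. Predicates. $\varphi\in\mathsf{P}(I)$ is supercompact ($\mathbf{SK_p}$) if whenever $\varphi\leq\exists_f(\psi)$ with $f:J\to I$ a function and $\psi\in\mathsf{P}(J)$, there is a function $g:I\to J$ with $\varphi\leq\mathsf{P}_g(\psi)$ and $f\circ g=\mathrm{id}_I$. The category $\mathbf{Reg}_{\mathsf{P}}$. Objects are pairs $(A,\alpha)$ with $A$ a set and $\alpha\in\mathsf{P}(A)$. An arrow $(A,\alpha)\to(B,\beta)$ is an element $\phi\in\mathsf{P}(A\times B)$ such that (1) $\phi\leq\mathsf{P}_{\pi_1}(\alpha)\wedge\mathsf{P}_{\pi_2}(\beta)$; (2) $\alpha\leq\exists_{\pi_1}(\phi)$; (3) $\mathsf{P}_{\langle\pi_1,\pi_2\rangle}(\phi)\wedge\mathsf{P}_{\langle\pi_1,\pi_3\rangle}(\phi)\leq\mathsf{P}_{\langle\pi_2,\pi_3\rangle}(\delta_B)$ (projections from $A\times B\times B$). Composition of $\phi:(A,\alpha)\to(B,\beta)$ and $\psi:(B,\beta)\to(C,\gamma)$ is $\exists_{\langle\pi_1,\pi_3\rangle}(\mathsf{P}_{\langle\pi_1,\pi_2\rangle}(\phi)\wedge\mathsf{P}_{\langle\pi_2,\pi_3\rangle}(\psi))$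 (projections from $A\times B\times C$); the identity of $(A,\alpha)$ is $\exists_{\Delta_A}(\alpha)$. $\mathbf{Reg}_{\mathsf{P}}$ is a regular category. Strong trackability. An arrow $\phi:(A,\alpha)\to(B,\beta)$ of $\mathbf{Reg}_{\mathsf{P}}$ is strongly trackable if there is a unique function $f_\phi:A\to B$ with $\alpha\leq\mathsf{P}_{\langle\mathrm{id}_A,f_\phi\rangle}(\phi)$. An object $(A,\alpha)$ is strongly trackable if every arrow of $\mathbf{Reg}_{\mathsf{P}}$ with domain $(A,\alpha)$ is strongly trackable. An object is regular projective if every arrow from it into the codomain of a regular epimorphism lifts through that regular epimorphism. *)

(* Defs.v *)
From HB Require Import structures.
From mathcomp Require Import all_boot all_order.
From mathcomp Require Import boolp classical_sets.

Set Implicit Arguments.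
Unset Strict Implicit.
Unset Printing Implicit Defensive.

Import Order.Theory.
Local Open Scope order_scope.
Local Open Scope classical_set_scope.

(* All sets of the category Set (the index sets of the tripos, hence also the
   underlying sets of the objects of Reg_P) live in this one universe level. *)
Definition SET := Type.

(* A poset in which every subset has an infimum is a complete lattice. *)
Record implicativeAlgebra (d : Order.disp_t) := ImplicativeAlgebra {
  carrier :> porderType d;
  inf : set carrier -> carrier;
  imp : carrier -> carrier -> carrier;
  sep : set carrier;
  inf_infimum : forall B, infimums B (inf B);
  imp_mono : forall a a' b b', a' <= a -> b <= b' -> imp a b <= imp a' b';
  imp_inf : forall a B, imp a (inf B) = inf (imp a @` B);
  sep_up : forall a b, a <= b -> sep a -> sep b;
  sepK : sep (inf [set x | exists a b, x = imp a (imp b a)]);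
  sepS : sep (inf [set x | exists a b c,
           x = imp (imp a (imp b c)) (imp (imp a b) (imp a c))]);
  sep_mp : forall a b, sep (imp a b) -> sep a -> sep b
}.
Arguments inf {d i}.
Arguments imp {d i}.
Arguments sep {d}.

Declare Scope impl_scope.
Delimit Scope impl_scope with impl.
Local Open Scope impl_scope.
Notation "a ~> b" := (imp a b) (at level 55, right associativity) : impl_scope.

Section Connectives.
Context {d : Order.disp_t} {AA : implicativeAlgebra d}.
Implicit Types (I J K M X : SET) (a b x : AA).

Definition iinf (I : Type) (c : I -> AA) : AA := inf (range c).

Definition iprod a b : AA := iinf (fun x => (a ~> b ~> x) ~> x).

Definition iex (I : Type) (c : I -> AA) : AA :=
  iinf (fun x => iinf (fun i => c i ~> x) ~> x).

Definition entails I (phi psi : I -> AA) : bool :=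
  iinf (fun i => phi i ~> psi i) \in sep AA.

Definition ex_along I X (f : I -> X) (phi : I -> AA) (x : X) : AA :=
  iex (fun i : {i : I | f i = x} => phi (sval i)).

Lemma le_iinf (I : Type) (c : I -> AA) a :
  (forall i, a <= c i) -> a <= iinf c.
Proof.
move=> h; have [_] := inf_infimum (range c); apply=> _ [i _ <-]; exact: h.
Qed.

Lemma iinf_le (I : Type) (c : I -> AA) i : iinf c <= c i.
Proof. by have [+ _] := inf_infimum (range c); apply; exists i. Qed.

Lemma imp_iinf (I : Type) a (c : I -> AA) :
  a ~> iinf c = iinf (fun i => a ~> c i).
Proof. by rewrite /iinf imp_inf image_comp. Qed.

(* Validity of a family, and of a sequent whose hypotheses are listed with the
   innermost one first. *)
Definition valid (I : Type) (c : I -> AA) : Prop := sep AA (iinf c).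

Fixpoint prov (I : Type) (l : seq (I -> AA)) (c : I -> AA) : Prop :=
  if l is h :: l' then prov l' (fun i => h i ~> c i) else valid c.

Lemma valid_mp (I : Type) (a b : I -> AA) :
  valid (fun i => a i ~> b i) -> valid a -> valid b.
Proof.
move=> hab ha; apply: sep_mp ha; apply: sep_up hab.
rewrite imp_iinf; apply: le_iinf => i; apply: le_trans (iinf_le _ i) _.
by apply: imp_mono => //; exact: iinf_le.
Qed.

Lemma validK (I : Type) (a b : I -> AA) : valid (fun i => a i ~> b i ~> a i).
Proof.
apply: sep_up (sepK AA); apply: le_iinf => i.
by have [+ _] := inf_infimum [set x : AA | exists a b, x = imp a (imp b a)];
  apply; exists (a i), (b i).
Qed.

Lemma validS (I : Type) (a b c : I -> AA) :
  valid (fun i => (a i ~> b i ~> c i) ~> (a i ~> b i) ~> a i ~> c i).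
Proof.
apply: sep_up (sepS AA); apply: le_iinf => i.
by have [+ _] := inf_infimum [set x : AA | exists a b c,
  x = imp (imp a (imp b c)) (imp (imp a b) (imp a c))];
  apply; exists (a i), (b i), (c i).
Qed.

Lemma valid_refl (I : Type) (a : I -> AA) : valid (fun i => a i ~> a i).
Proof.
apply: valid_mp (validK a a).
exact: valid_mp (validS a (fun i => a i ~> a i) a) (validK _ _).
Qed.

Lemma valid_le (I : Type) (a b : I -> AA) :
  (forall i, a i <= b i) -> valid (fun i => a i ~> b i).
Proof.
move=> h; apply: sep_up (valid_refl a); apply: le_iinf => i.
by apply: le_trans (iinf_le _ i) _; apply: imp_mono.
Qed.

Lemma valid_map (I J : Type) (f : J -> I) (a : I -> AA) :
  valid a -> valid (fun j => a (f j)).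
Proof. by apply: sep_up; apply: le_iinf => j; exact: iinf_le. Qed.

Lemma prov_valid (I : Type) l (c : I -> AA) : valid c -> prov l c.
Proof.
by elim: l c => [|h l IH] c //= hc; apply: IH; apply: valid_mp hc; exact: validK.
Qed.

Lemma prov_mp (I : Type) l (a b : I -> AA) :
  prov l (fun i => a i ~> b i) -> prov l a -> prov l b.
Proof.
elim: l a b => [|h l IH] a b /=; first exact: valid_mp.
move=> hab; apply: (IH _ _ _); apply: (IH _ _ _) hab.
by apply: prov_valid; exact: validS.
Qed.

Lemma prov_weak (I : Type) l (h c : I -> AA) : prov l c -> prov (h :: l) c.
Proof. by move=> hc /=; apply: prov_mp hc; apply: prov_valid; exact: validK. Qed.

Lemma prov0 (I : Type) l (h : I -> AA) : prov (h :: l) h.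
Proof. by apply: (@prov_valid _ l); exact: valid_refl. Qed.

Lemma prov1 (I : Type) l (h h' : I -> AA) : prov (h' :: h :: l) h.
Proof. by apply: prov_weak; exact: prov0. Qed.

Lemma prov2 (I : Type) l (h h' h'' : I -> AA) : prov (h'' :: h' :: h :: l) h.
Proof. by apply: prov_weak; exact: prov1. Qed.

Lemma prov_iinf (I : Type) (J : I -> Type) l (c : forall i, J i -> AA) :
  prov [seq h \o tag | h <- l] (fun p : {i & J i} => c (tag p) (tagged p)) ->
  prov l (fun i => iinf (c i)).
Proof.
elim: l c => [|h l IH] c /=.
  apply: sep_up; apply: le_iinf => i; apply: le_iinf => j.
  exact: (iinf_le _ (existT _ i j)).
move=> hc; have := IH (fun i j => h i ~> c i j) hc.
by congr (prov _ _); apply/funext => i; rewrite imp_iinf.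
Qed.

Lemma prov_pair (I : Type) l (a b : I -> AA) :
  prov l a -> prov l b -> prov l (fun i => iprod (a i) (b i)).
Proof.
have h : valid (fun i => a i ~> b i ~> iprod (a i) (b i)).
  apply: (@prov_iinf _ _ [:: b; a] (fun i x => (a i ~> b i ~> x) ~> x)).
  pose A := a \o @tag I (fun=> AA); pose B := b \o @tag I (fun=> AA).
  change (prov [:: B; A] (fun p => (A p ~> B p ~> tagged p) ~> tagged p)).
  apply: (@prov_mp _ [:: _; B; A] B (fun p => tagged p)); last exact: prov1.
  by apply: (@prov_mp _ [:: _; B; A] A); [exact: prov0 | exact: prov2].
move=> ha hb; apply: prov_mp hb; apply: prov_mp ha; exact: prov_valid h.
Qed.

Lemma prov_fst (I : Type) l (a b : I -> AA) :
  prov l (fun i => iprod (a i) (b i)) -> prov l a.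
Proof.
move=> h; apply: (@prov_mp _ _ (fun i => a i ~> b i ~> a i)).
  apply: prov_mp h; apply: prov_valid; apply: valid_le => i.
  exact: (iinf_le _ (a i)).
by apply: prov_valid; exact: validK.
Qed.

Lemma prov_snd (I : Type) l (a b : I -> AA) :
  prov l (fun i => iprod (a i) (b i)) -> prov l b.
Proof.
move=> h; apply: (@prov_mp _ _ (fun i => a i ~> b i ~> b i)).
  apply: prov_mp h; apply: prov_valid; apply: valid_le => i.
  exact: (iinf_le _ (b i)).
apply: prov_valid; apply: (@valid_mp _ (fun i => b i ~> b i)); last exact: valid_refl.
exact: validK.
Qed.

Lemma entailsP I (phi psi : I -> AA) :
  reflect (prov [:: phi] psi) (entails phi psi).
Proof. by apply: (iffP idP) => [/set_mem|] //= h; apply/mem_set. Qed.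

Lemma entails_refl I : reflexive (@entails I).
Proof. by move=> phi; apply/entailsP; exact: prov0. Qed.

Lemma entails_trans I : transitive (@entails I).
Proof.
move=> psi phi chi /entailsP h1 /entailsP h2; apply/entailsP.
by apply: prov_mp h1; exact: prov_valid.
Qed.

Lemma entails_prod I (phi psi chi : I -> AA) :
  entails phi (fun i => iprod (psi i) (chi i)) =
  entails phi psi && entails phi chi.
Proof.
apply/entailsP/andP => [h|[/entailsP h1 /entailsP h2]]; last exact: prov_pair.
by split; apply/entailsP; [exact: prov_fst h | exact: prov_snd h].
Qed.

Lemma entails_top I (phi : I -> AA) : entails phi (fun=> inf set0).
Proof.
apply/entailsP; apply: valid_le => i.
by have [_] := inf_infimum (set0 : set AA); apply.
Qed.

Lemma entails_map I J (f : J -> I) (phi psi : I -> AA) :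
  entails phi psi -> entails (phi \o f) (psi \o f).
Proof. by move=> /entailsP h; apply/entailsP; exact: (valid_map f h). Qed.

Lemma entails_ex_intro I X M (f : I -> X) (m : M -> I) (phi : I -> AA) :
  entails (phi \o m) (ex_along f phi \o f \o m).
Proof.
apply/entailsP; apply: (@prov_iinf _ _ [:: phi \o m]
  (fun k x => iinf (fun i : {i | f i = f (m k)} => phi (sval i) ~> x) ~> x)).
pose C := (phi \o m) \o @tag M (fun=> AA).
pose H (p : {_ : M & AA}) := iinf (fun i : {i | f i = f (m (tag p))} =>
  phi (sval i) ~> tagged p).
change (prov [:: H; C] (fun p => tagged p)).
apply: (@prov_mp _ [:: H; C] C (fun p => tagged p)); last exact: prov1.
apply: (@prov_mp _ [:: H; C] H); last exact: prov0.
apply: prov_valid; apply: valid_le => p.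
exact: (iinf_le (fun i : {i | f i = f (m (tag p))} => phi (sval i) ~> tagged p)
  (exist (fun i => f i = f (m (tag p))) (m (tag p)) erefl)).
Qed.

Lemma entails_ex_elim I X K (f : I -> X) (g : K -> X) (phi : I -> AA)
    (gamma chi : K -> AA) :
  entails (fun p : {p : K * I | f p.2 = g p.1} =>
             iprod (gamma (sval p).1) (phi (sval p).2))
          (fun p => chi (sval p).1) ->
  entails (fun k => iprod (gamma k) (ex_along f phi (g k))) chi.
Proof.
move=> /entailsP h; apply/entailsP.
set H := (fun k => iprod _ _).
have hg : prov [:: H] gamma by apply: prov_fst; exact: prov0.
have he : prov [:: H] (ex_along f phi \o g) by apply: prov_snd; exact: prov0.
apply: (@prov_mp _ [:: H]
  (fun k => iinf (fun i : {i | f i = g k} => phi (sval i) ~> chi k))).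
  apply: prov_mp he; apply: prov_valid; apply: valid_le => k.
  exact: (iinf_le _ (chi k)).
apply: (@prov_iinf _ _ [:: H]
  (fun k (i : {i | f i = g k}) => phi (sval i) ~> chi k)) => /=.
pose T : Type := {k : K & {i | f i = g k}}.
pose e (p : T) : {p : K * I | f p.2 = g p.1} :=
  exist _ (tag p, sval (tagged p)) (svalP (tagged p)).
pose F (p : T) := phi (sval (tagged p)).
apply: (@prov_mp _ [:: F; H \o tag]
  (fun p : T => iprod (gamma (tag p)) (phi (sval (tagged p))))).
  apply: prov_valid; exact: (valid_map e h).
apply: prov_pair; last exact: prov0.
apply: prov_weak; exact: (valid_map (@tag K _) hg).
Qed.

Definition interentails I : rel (I -> AA) :=
  fun phi psi => entails phi psi && entails psi phi.

Lemma interentails_refl I : reflexive (@interentails I).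
Proof. by move=> phi; rewrite /interentails !entails_refl. Qed.

Lemma interentails_sym I : symmetric (@interentails I).
Proof. by move=> phi psi; rewrite /interentails andbC. Qed.

Lemma interentails_trans I : transitive (@interentails I).
Proof.
move=> psi phi chi /andP[h1 h2] /andP[h3 h4].
by apply/andP; split; [exact: entails_trans h3 | exact: entails_trans h2].
Qed.

Canonical interentails_equiv I :=
  EquivRel (@interentails I) (@interentails_refl I) (@interentails_sym I)
    (@interentails_trans I).

End Connectives.

Local Close Scope classical_set_scope.
Local Open Scope quotient_scope.

(* P(I): the posetal reflection of the preorder of I-indexed families. *)
Definition tripos d (AA : implicativeAlgebra d) (I : SET) :=
  {eq_quot (@interentails d AA I)}.

Fact tripos_display : Order.disp_t. Proof. exact: Order.Disp tt tt. Qed.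

Section TriposOrder.
Context {d : Order.disp_t} {AA : implicativeAlgebra d} {I : SET}.
Local Notation P := (tripos AA I).

HB.instance Definition _ := Choice.on P.
HB.instance Definition _ := Quotient.on P.

Definition tripos_le (phi psi : P) : bool := entails (repr phi) (repr psi).

Definition tripos_meet (phi psi : P) : P :=
  \pi_P (fun i => iprod (repr phi i) (repr psi i)).

Definition tripos_top : P := \pi_P (fun=> inf set0).

Lemma repr_pi (phi : I -> AA) :
  entails (repr (\pi_P phi)) phi /\ entails phi (repr (\pi_P phi)).
Proof.
apply/andP; rewrite -/(interentails _ _).
by apply/(@eqmodP _ (interentails_equiv I)); rewrite reprK.
Qed.

Lemma tripos_le_pi (phi psi : I -> AA) :
  tripos_le (\pi_P phi) (\pi_P psi) = entails phi psi.
Proof.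
have [h1 h2] := repr_pi phi; have [h3 h4] := repr_pi psi.
apply/idP/idP => h; last first.
  exact: entails_trans h1 (entails_trans h h4).
exact: entails_trans h2 (entails_trans h h3).
Qed.

Lemma tripos_le_refl : reflexive tripos_le.
Proof. by move=> phi; exact: entails_refl. Qed.

Lemma tripos_le_anti : antisymmetric tripos_le.
Proof.
by move=> phi psi h; rewrite -[phi]reprK -[psi]reprK; apply/(@eqmodP _ (interentails_equiv I)).
Qed.

Lemma tripos_le_trans : transitive tripos_le.
Proof. by move=> psi phi chi; exact: entails_trans. Qed.

HB.instance Definition _ := Order.Le_isPOrder.Build tripos_display P
  tripos_le_refl tripos_le_anti tripos_le_trans.

Lemma tripos_lexI (phi psi chi : P) :
  (phi <= tripos_meet psi chi) = (phi <= psi) && (phi <= chi).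
Proof.
change (tripos_le phi (tripos_meet psi chi) =
  tripos_le phi psi && tripos_le phi chi).
by rewrite -[in LHS](reprK phi) tripos_le_pi entails_prod.
Qed.

HB.instance Definition _ :=
  Order.POrder_isMeetSemilattice.Build tripos_display P tripos_lexI.

Lemma tripos_lex1 (phi : P) : phi <= tripos_top.
Proof.
change (tripos_le phi tripos_top).
rewrite -[phi]reprK tripos_le_pi; exact: entails_top.
Qed.

HB.instance Definition _ :=
  Order.hasTop.Build tripos_display P tripos_lex1.

End TriposOrder.

Section TriposStructure.
Context {d : Order.disp_t} {AA : implicativeAlgebra d}.
Implicit Types (I J K M X Y : SET).
Local Notation P := (tripos AA).

Definition reindex I X (f : I -> X) (phi : P X) : P I :=
  \pi_(P I) (repr phi \o f).

Definition tex I X (f : I -> X) (phi : P I) : P X :=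
  \pi_(P X) (ex_along f (repr phi)).

Definition delta X : P (X * X)%type := tex (fun x => (x, x)) \top.

Definition supercompact I (phi : P I) : Prop :=
  forall J (f : J -> I) (psi : P J), phi <= tex f psi ->
  exists2 g : I -> J, phi <= reindex g psi & f \o g = id.

Lemma le_tripos_pi I (phi psi : I -> AA) :
  (\pi_(P I) phi <= \pi_(P I) psi) = entails phi psi.
Proof. exact: tripos_le_pi. Qed.

Lemma reindex_pi I X (f : I -> X) (phi : X -> AA) :
  reindex f (\pi_(P X) phi) = \pi_(P I) (phi \o f).
Proof.
have [h1 h2] := repr_pi phi.
by apply: le_anti; rewrite !le_tripos_pi; apply/andP; split; apply: entails_map.
Qed.

Lemma reindex_le I X (f : I -> X) (phi psi : P X) :
  phi <= psi -> reindex f phi <= reindex f psi.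
Proof. by move=> h; rewrite le_tripos_pi; exact: entails_map. Qed.

Lemma reindex_comp I J X (f : I -> X) (g : J -> I) (phi : P X) :
  reindex g (reindex f phi) = reindex (f \o g) phi.
Proof. exact: reindex_pi. Qed.

Lemma reindex_id X (phi : P X) : reindex id phi = phi.
Proof. by rewrite -[RHS]reprK. Qed.

Lemma reindex_meet I X (f : I -> X) (phi psi : P X) :
  reindex f (phi `&` psi) = reindex f phi `&` reindex f psi.
Proof.
rewrite -[phi]reprK -[psi]reprK; set a := repr phi; set b := repr psi.
have meet_pi Y (u v : Y -> AA) :
    \pi_(P Y) u `&` \pi_(P Y) v = \pi_(P Y) (fun y => iprod (u y) (v y)).
  have [h1 h2] := repr_pi u; have [h3 h4] := repr_pi v.
  apply: le_anti; apply/andP; split.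
    have H : forall w, w <= \pi_(P Y) u `&` \pi_(P Y) v ->
        w <= \pi_(P Y) (fun y => iprod (u y) (v y)).
      move=> w; rewrite lexI -[w]reprK !le_tripos_pi => /andP[hu hv].
      by rewrite entails_prod hu.
    exact: H.
  have := entails_refl (fun y => iprod (u y) (v y)).
  by rewrite entails_prod lexI !le_tripos_pi.
by rewrite meet_pi !reindex_pi meet_pi.
Qed.

Lemma reindex_top I X (f : I -> X) : reindex f (\top : P X) = \top.
Proof. exact: reindex_pi. Qed.

Lemma tex_intro I X M (f : I -> X) (m : M -> I) (phi : P I) :
  reindex m phi <= reindex (f \o m) (tex f phi).
Proof. rewrite reindex_pi le_tripos_pi; exact: entails_ex_intro. Qed.

(* Elimination of an existential at a generalized element g; it subsumes the
   adjunction, the Frobenius law and the Beck-Chevalley condition. *)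
Lemma tex_use I X K (f : I -> X) (g : K -> X) (phi : P I) (gamma chi : P K) :
  gamma <= reindex g (tex f phi) ->
  (forall M (k : M -> K) (i : M -> I), (forall m, f (i m) = g (k m)) ->
    reindex k gamma `&` reindex i phi <= reindex k chi) ->
  gamma <= chi.
Proof.
move=> h1 h2; apply: (@le_trans _ _ (gamma `&` reindex g (tex f phi))).
  by rewrite lexI lexx.
have := h2 {p : K * I | f p.2 = g p.1} (fun p => (sval p).1)
  (fun p => (sval p).2) (fun p => svalP p).
rewrite -[gamma]reprK -[chi]reprK; set a := repr gamma; set b := repr chi.
rewrite !reindex_pi => h.
have h' : entails (fun p : {p : K * I | f p.2 = g p.1} =>
    iprod (a (sval p).1) (repr phi (sval p).2)) (fun p => b (sval p).1).
  rewrite -le_tripos_pi; apply: le_trans h.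
  rewrite lexI !le_tripos_pi -entails_prod; exact: entails_refl.
have := entails_ex_elim h'; rewrite -le_tripos_pi; apply: le_trans.
set L := _ `&` _; rewrite -[L]reprK le_tripos_pi entails_prod -!le_tripos_pi.
by rewrite reprK leIl leIr.
Qed.

Lemma tex_adj I X (f : I -> X) (phi : P I) (psi : P X) :
  (tex f phi <= psi) = (phi <= reindex f psi).
Proof.
apply/idP/idP => h.
  apply: le_trans (reindex_le f h).
  by rewrite -{1}[phi]reindex_id; exact: (tex_intro f id).
apply: (@tex_use I X X f id phi) => [|M k i e]; first by rewrite reindex_id.
apply: le_trans (leIr _ _) _; apply: le_trans (reindex_le i h) _.
by rewrite reindex_comp (_ : f \o i = k) //; apply/funext.
Qed.

Lemma delta_refl M X (u : M -> X) (gamma : P M) :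
  gamma <= reindex (fun m => (u m, u m)) (delta X).
Proof.
apply: le_trans (tex_intro (fun x : X => (x, x)) u \top).
by rewrite reindex_top lex1.
Qed.

Lemma delta_use K X (u v : K -> X) (gamma chi : P K) :
  gamma <= reindex (fun m => (u m, v m)) (delta X) ->
  (forall M (k : M -> K), u \o k = v \o k ->
    reindex k gamma <= reindex k chi) ->
  gamma <= chi.
Proof.
move=> h1 h2; apply: tex_use h1 _ => M k i e.
apply: le_trans (leIl _ _) _; apply: h2; apply/funext => m /=.
by have [<- <-] := e m.
Qed.

End TriposStructure.

Section Arrows.
Context {d : Order.disp_t} {AA : implicativeAlgebra d}.
Implicit Types (A B C D M K : SET).
Local Notation P := (tripos AA).

Definition pi12 A B C (t : A * B * C) : A * B := (t.1.1, t.1.2).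
Definition pi13 A B C (t : A * B * C) : A * C := (t.1.1, t.2).
Definition pi23 A B C (t : A * B * C) : B * C := (t.1.2, t.2).

Definition is_arrow A B (alpha : P A) (beta : P B) (phi : P (A * B)%type) :=
  [&& phi <= reindex fst alpha `&` reindex snd beta,
      alpha <= tex fst phi &
      reindex (@pi12 A B B) phi `&` reindex (@pi13 A B B) phi
        <= reindex (@pi23 A B B) (delta B)].

Definition comp_pred A B C (psi : P (B * C)%type) (phi : P (A * B)%type) :
    P (A * C)%type :=
  tex (@pi13 A B C) (reindex (@pi12 A B C) phi `&` reindex (@pi23 A B C) psi).

Definition id_pred A (alpha : P A) : P (A * A)%type :=
  tex (fun a => (a, a)) alpha.

Lemma arrow_dom A B alpha beta phi M (u : M -> A) (v : M -> B) gamma :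
  is_arrow alpha beta phi -> gamma <= reindex (fun m => (u m, v m)) phi ->
  gamma <= reindex u alpha.
Proof.
case/and3P; rewrite lexI => /andP[h _] _ _ hg; apply: le_trans hg _.
by apply: le_trans (reindex_le _ h) _; rewrite reindex_comp.
Qed.

Lemma arrow_cod A B alpha beta phi M (u : M -> A) (v : M -> B) gamma :
  is_arrow alpha beta phi -> gamma <= reindex (fun m => (u m, v m)) phi ->
  gamma <= reindex v beta.
Proof.
case/and3P; rewrite lexI => /andP[_ h] _ _ hg; apply: le_trans hg _.
by apply: le_trans (reindex_le _ h) _; rewrite reindex_comp.
Qed.

Lemma arrow_total A B alpha beta phi K (u : K -> A) gamma chi :
  is_arrow alpha beta phi -> gamma <= reindex u alpha ->
  (forall M (k : M -> K) (v : M -> B),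
     reindex k gamma `&` reindex (fun m => (u (k m), v m)) phi
       <= reindex k chi) ->
  gamma <= chi.
Proof.
case/and3P=> _ h _ hg hchi.
apply: tex_use (le_trans hg (reindex_le u h)) _ => M k i e.
have -> : i = (fun m => (u (k m), (i m).2)).
  by apply/funext => m; rewrite -e; case: (i m).
exact: hchi.
Qed.

Lemma arrow_sv A B alpha beta phi K (u : K -> A) (v w : K -> B) gamma chi :
  is_arrow alpha beta phi ->
  gamma <= reindex (fun m => (u m, v m)) phi ->
  gamma <= reindex (fun m => (u m, w m)) phi ->
  (forall M (k : M -> K), v \o k = w \o k -> reindex k gamma <= reindex k chi) ->
  gamma <= chi.
Proof.
case/and3P=> _ _ h hv hw; apply: delta_use.
apply: (@le_trans _ _ (reindex (fun m => (u m, v m, w m))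
  (reindex (@pi12 A B B) phi `&` reindex (@pi13 A B B) phi))).
  by rewrite reindex_meet !reindex_comp lexI hv.
by apply: le_trans (reindex_le _ h) _; rewrite reindex_comp.
Qed.

Lemma comp_intro A B C (psi : P (B * C)%type) (phi : P (A * B)%type) K
    (u : K -> A) (v : K -> B) (w : K -> C) gamma :
  gamma <= reindex (fun m => (u m, v m)) phi ->
  gamma <= reindex (fun m => (v m, w m)) psi ->
  gamma <= reindex (fun m => (u m, w m)) (comp_pred psi phi).
Proof.
move=> h1 h2; apply: le_trans (tex_intro _ (fun m => (u m, v m, w m)) _).
by rewrite reindex_meet !reindex_comp lexI h1.
Qed.

Lemma comp_use A B C (psi : P (B * C)%type) (phi : P (A * B)%type) K
    (u : K -> A) (w : K -> C) gamma chi :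
  gamma <= reindex (fun m => (u m, w m)) (comp_pred psi phi) ->
  (forall M (k : M -> K) (v : M -> B) (gamma' : P M),
     gamma' <= reindex k gamma ->
     gamma' <= reindex (fun m => (u (k m), v m)) phi ->
     gamma' <= reindex (fun m => (v m, w (k m))) psi ->
     gamma' <= reindex k chi) ->
  gamma <= chi.
Proof.
move=> h1 h2; apply: tex_use h1 _ => M k i e.
have e1 m : (i m).1.1 = u (k m) by have [] := e m.
have e2 m : (i m).2 = w (k m) by have [] := e m.
apply: (h2 _ _ (fun m => (i m).1.2)); first exact: leIl.
  apply: le_trans (leIr _ _) _; rewrite reindex_meet !reindex_comp.
  apply: le_trans (leIl _ _) _; rewrite /comp /pi12.
  by under eq_fun do rewrite e1.
apply: le_trans (leIr _ _) _; rewrite reindex_meet !reindex_comp.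
apply: le_trans (leIr _ _) _; rewrite /comp /pi23.
by under eq_fun do rewrite e2.
Qed.

Lemma id_intro A (alpha : P A) K (u : K -> A) gamma :
  gamma <= reindex u alpha ->
  gamma <= reindex (fun m => (u m, u m)) (id_pred alpha).
Proof. move=> h; apply: le_trans h _; exact: tex_intro. Qed.

Lemma id_use A (alpha : P A) K (u v : K -> A) gamma chi :
  gamma <= reindex (fun m => (u m, v m)) (id_pred alpha) ->
  (forall M (k : M -> K) (gamma' : P M), u \o k = v \o k ->
     gamma' <= reindex k gamma -> gamma' <= reindex (u \o k) alpha ->
     gamma' <= reindex k chi) ->
  gamma <= chi.
Proof.
move=> h1 h2; apply: tex_use h1 _ => M k i e.
have eu : u \o k = i by apply/funext => m; have [] := e m.
have ev : v \o k = i by apply/funext => m; have [] := e m.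
by apply: h2; rewrite ?eu ?ev ?leIl ?leIr.
Qed.

Lemma le_reindex_pair A B K (w : K -> A * B) (phi : P (A * B)%type) gamma :
  gamma <= reindex (fun m => ((w m).1, (w m).2)) phi -> gamma <= reindex w phi.
Proof. by under eq_fun do rewrite -surjective_pairing. Qed.

Lemma le_at A B (phi chi : P (A * B)%type) :
  (forall K (u : K -> A) (v : K -> B) (gamma : P K),
     gamma <= reindex (fun m => (u m, v m)) phi ->
     gamma <= reindex (fun m => (u m, v m)) chi) ->
  phi <= chi.
Proof.
move=> h; rewrite -[chi]reindex_id; apply: le_reindex_pair; apply: h.
rewrite (_ : (fun m : A * B => _) = id) ?reindex_id //.
by apply/funext => -[].
Qed.

Lemma is_arrowP A B (alpha : P A) (beta : P B) (phi : P (A * B)%type) :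
  (forall K (u : K -> A) (v : K -> B) gamma,
     gamma <= reindex (fun m => (u m, v m)) phi ->
     gamma <= reindex u alpha /\ gamma <= reindex v beta) ->
  alpha <= tex fst phi ->
  (forall K (u : K -> A) (v w : K -> B) gamma,
     gamma <= reindex (fun m => (u m, v m)) phi ->
     gamma <= reindex (fun m => (u m, w m)) phi ->
     gamma <= reindex (fun m => (v m, w m)) (delta B)) ->
  is_arrow alpha beta phi.
Proof.
move=> h1 h2 h3; apply/and3P; split=> //.
  by rewrite lexI; apply/andP; apply: (h1 _ fst snd); apply: le_reindex_pair;
     rewrite (_ : (fun m : A * B => _) = id) ?reindex_id //; apply/funext => -[].
apply: (h3 _ (fun t => t.1.1) (fun t => t.1.2) (fun t => t.2)).
  exact: leIl.
exact: leIr.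
Qed.

Lemma le_tex_fst A B K (u : K -> A) (v : K -> B) (phi : P (A * B)%type) gamma :
  gamma <= reindex (fun m => (u m, v m)) phi ->
  gamma <= reindex u (tex fst phi).
Proof. by move=> h; apply: le_trans h _; exact: tex_intro. Qed.

Lemma reindex_at K M X (k : M -> K) (m : K -> X) (phi : P X) gamma gamma' :
  gamma' <= reindex k gamma -> gamma <= reindex m phi ->
  gamma' <= reindex (m \o k) phi.
Proof.
by move=> h1 h2; apply: le_trans h1 _; rewrite -reindex_comp; exact: reindex_le.
Qed.

Lemma is_arrow_id A (alpha : P A) : is_arrow alpha alpha (id_pred alpha).
Proof.
apply: is_arrowP => [K u v gamma h||K u v w gamma h1 h2].
- split; apply: id_use (h) _ => M k gamma' e _; rewrite reindex_comp //.
  by rewrite -e.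
- rewrite -[X in X <= _]reindex_id -[tex _ _]reindex_id.
  by apply: (@le_tex_fst _ _ _ id id); apply: id_intro.
- apply: id_use (h1) _ => M k gamma' e1 hg _.
  have h2' := reindex_at hg h2.
  apply: (@id_use _ alpha _ (u \o k) (w \o k)) h2' _.
  move=> N l gamma'' e2 _ _; rewrite !reindex_comp.
  rewrite (_ : _ \o (k \o l) = fun n => (u (k (l n)), u (k (l n)))).
    exact: delta_refl.
  apply/funext => n /=; congr pair.
    by rewrite -[v _]/((v \o k) (l n)) -e1.
  by rewrite -[w _]/((w \o k \o l) n) -e2.
Qed.

Lemma is_arrow_comp A B C (alpha : P A) (beta : P B) (gam : P C) psi phi :
  is_arrow beta gam psi -> is_arrow alpha beta phi ->
  is_arrow alpha gam (comp_pred psi phi).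
Proof.
move=> hpsi hphi; apply: is_arrowP => [K u w gamma h||K u w w' gamma h1 h2].
- split; apply: comp_use (h) _ => M k v gamma' _ h1 h2; rewrite reindex_comp.
    exact: arrow_dom hphi h1.
  exact: arrow_cod hpsi h2.
- apply: (arrow_total (u := id) hphi); first by rewrite reindex_id.
  move=> M k v; set G := _ `&` _.
  have hG : G <= reindex (fun m => (k m, v m)) phi by exact: leIr.
  apply: (arrow_total hpsi (arrow_cod hphi hG)) => N l w; set G' := _ `&` _.
  have hG' : G' <= reindex l G by exact: leIl.
  rewrite reindex_comp; apply: (le_tex_fst (v := w)).
  apply: (comp_intro (v := v \o l)); last exact: leIr.
  exact: reindex_at hG' hG.
- apply: comp_use (h1) _ => M k v G hG hv hw.
  apply: (comp_use (u := u \o k) (w := w' \o k)); first exact: (reindex_at hG h2).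
  move=> N l v' G' hG' hv' hw'.
  apply: (arrow_sv hphi (reindex_at hG' hv) hv') => L j e; rewrite !reindex_comp.
  have hj : reindex j G' <= reindex j G' by [].
  have := reindex_at hj (reindex_at hG' hw).
  rewrite (_ : _ \o _ \o _ = fun n => ((v' (j n)), w (k (l (j n))))); last first.
    by apply/funext => n /=; rewrite -[v' _]/((v' \o j) n) -e.
  move=> hw2; apply: (arrow_sv hpsi hw2 (reindex_at hj hw')) => L' i e'.
  rewrite !reindex_comp.
  rewrite [X in reindex X (delta _)](_ : _ = fun n => (w (k (l (j (i n)))), w (k (l (j (i n)))))).
    exact: delta_refl.
  apply/funext => n /=; congr pair.
  by have /(congr1 (@^~ n)) := e'.
Qed.

Lemma comp_pred_id_l A B (alpha : P A) (beta : P B) phi :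
  is_arrow alpha beta phi -> comp_pred (id_pred beta) phi = phi.
Proof.
move=> hphi; apply: le_anti; apply/andP; split; apply: le_at => K u v G h.
  apply: (comp_use h) => M k v' G' _ h1 h2.
  apply: (id_use h2) => N l G'' e hG _; rewrite !reindex_comp.
  have := reindex_at hG h1; congr (_ <= reindex _ _).
  by apply/funext => n /=; have /(congr1 (@^~ n)) /= -> := e.
by apply: (comp_intro h); apply: id_intro; exact: arrow_cod hphi h.
Qed.

Lemma comp_pred_id_r A B (alpha : P A) (beta : P B) phi :
  is_arrow alpha beta phi -> comp_pred phi (id_pred alpha) = phi.
Proof.
move=> hphi; apply: le_anti; apply/andP; split; apply: le_at => K u v G h.
  apply: (comp_use h) => M k v' G' _ h1 h2.
  apply: (id_use h1) => N l G'' e hG _; rewrite !reindex_comp.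
  have := reindex_at hG h2; congr (_ <= reindex _ _).
  by apply/funext => n /=; have /(congr1 (@^~ n)) /= -> := e.
by apply: (comp_intro _ h); apply: id_intro; exact: arrow_dom hphi h.
Qed.

Lemma comp_predA A B C D (chi : P (C * D)%type) (psi : P (B * C)%type)
    (phi : P (A * B)%type) :
  comp_pred chi (comp_pred psi phi) = comp_pred (comp_pred chi psi) phi.
Proof.
apply: le_anti; apply/andP; split; apply: le_at => K u v G h.
  apply: (comp_use h) => M k w G' _ h1 h2.
  apply: (comp_use h1) => N l w' G'' hG h3 h4.
  rewrite !reindex_comp; apply: (comp_intro h3).
  by apply: (comp_intro h4); exact: reindex_at hG h2.
apply: (comp_use h) => M k w G' _ h1 h2.
apply: (comp_use h2) => N l w' G'' hG h3 h4.
rewrite !reindex_comp; apply: (comp_intro _ h4).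
by apply: (comp_intro _ h3); exact: reindex_at hG h1.
Qed.

End Arrows.

Record category := Category {
  ob :> Type;
  hom : ob -> ob -> Type;
  idc : forall A, hom A A;
  comp : forall A B C, hom B C -> hom A B -> hom A C;
  comp_idl : forall A B (f : hom A B), comp (idc B) f = f;
  comp_idr : forall A B (f : hom A B), comp f (idc A) = f;
  compA : forall A B C D (h : hom C D) (g : hom B C) (f : hom A B),
    comp h (comp g f) = comp (comp h g) f
}.
Arguments hom {c}.
Arguments idc {c}.
Arguments comp {c A B C}.

Section RegularProjectives.
Context {CC : category}.
Implicit Types A B C D X : CC.

Definition is_coequalizer X B C (u v : hom X B) (e : hom B C) : Prop :=
  comp e u = comp e v /\
  forall D (h : hom B D), comp h u = comp h v ->
    exists! k : hom C D, comp k e = h.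

Definition regular_epi B C (e : hom B C) : Prop :=
  exists X (u v : hom X B), is_coequalizer u v e.

Definition regular_projective A : Prop :=
  forall B C (e : hom B C) (h : hom A C), regular_epi e ->
    exists k : hom A B, comp e k = h.

End RegularProjectives.

Section RegP.
Context {d : Order.disp_t} (AA : implicativeAlgebra d).

Record reg_object := RegObject {
  base : SET;
  predicate : tripos AA base
}.

Record reg_arrow (X Y : reg_object) := RegArrow {
  graph : tripos AA (base X * base Y)%type;
  graph_arrow : is_arrow (predicate X) (predicate Y) graph
}.

Lemma graph_inj X Y : injective (@graph X Y).
Proof.
move=> [p hp] [q hq] /= e; rewrite -e in hq *.
by congr RegArrow; exact: bool_irrelevance.
Qed.

Definition reg_id X : reg_arrow X X := RegArrow (is_arrow_id (predicate X)).

Definition reg_comp X Y Z (psi : reg_arrow Y Z) (phi : reg_arrow X Y) :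
    reg_arrow X Z :=
  RegArrow (is_arrow_comp (graph_arrow psi) (graph_arrow phi)).

Lemma reg_comp_idl X Y (phi : reg_arrow X Y) : reg_comp (reg_id Y) phi = phi.
Proof. apply: graph_inj; exact: comp_pred_id_l (graph_arrow phi). Qed.

Lemma reg_comp_idr X Y (phi : reg_arrow X Y) : reg_comp phi (reg_id X) = phi.
Proof. apply: graph_inj; exact: comp_pred_id_r (graph_arrow phi). Qed.

Lemma reg_compA X Y Z W (chi : reg_arrow Z W) (psi : reg_arrow Y Z)
    (phi : reg_arrow X Y) :
  reg_comp chi (reg_comp psi phi) = reg_comp (reg_comp chi psi) phi.
Proof. apply: graph_inj; exact: comp_predA. Qed.

Definition RegP : category := Category reg_comp_idl reg_comp_idr reg_compA.

Definition strongly_trackable_arrow (X Y : RegP) (phi : hom X Y) : Prop :=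
  exists! f : base X -> base Y,
    predicate X <= reindex (fun a => (a, f a)) (graph phi).

Definition strongly_trackable (X : RegP) : Prop :=
  forall (Y : RegP) (phi : hom X Y), strongly_trackable_arrow phi.

End RegP.

(* Main.v *)
(* In Reg_P an arrow e : (B, beta) -> (C, gamma) that is a regular epimorphism
   is surjective, gamma <= exists_{pi_2} e, because it cannot factor through
   its image; conversely the arrow induced by a function f : J -> A is a regular
   epimorphism as soon as it is surjective.

   If (A, alpha) is regular projective and alpha <= exists_f psi, the arrow
   induced by f on psi /\ P_f alpha is a regular epimorphism onto (A, alpha).
   A section of it is tracked by some g, and f o g = id because f o g and id
   both track the identity arrow, whose tracking function is unique.

   If alpha is supercompact, an arrow h : (A, alpha) -> (C, gamma) is tracked by
   some t, so surjectivity of e gives alpha <= exists_{pi_1} e(b, t a) along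
   A x B -> A. The section provided by supercompactness is a -> (a, s a), and
   s induces a lift of h. *)
Require Import Defs.
From mathcomp Require Import all_boot all_order.
From mathcomp Require Import boolp.
(* [bigop.reindex] otherwise shadows [Defs.reindex]. *)
Import Defs.

Set Implicit Arguments.
Unset Strict Implicit.
Unset Printing Implicit Defensive.

Import Order.Theory.
Local Open Scope order_scope.

(** * Arrows of [RegP] induced by functions, computed on generalized elements *)

Section FunctionalArrows.
Context {d : Order.disp_t} {AA : implicativeAlgebra d}.
Implicit Types (A B C I J K M X : SET).
Local Notation P := (tripos AA).

Lemma reindex_ext K X (u v : K -> X) (phi : P X) (gamma : P K) :
  u =1 v -> gamma <= reindex u phi -> gamma <= reindex v phi.
Proof. by move=> /funext ->. Qed.

(** Where [psi] relates [u] to [v], totality of [phi] supplies some [w] with [phi (u, w)], hence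
    [psi (u, w)]; single-valuedness of [psi] identifies [w] with [v]. Equality of arrows thus
    reduces to one inclusion. *)
Lemma arrow_le_eq A B (alpha : P A) (beta : P B) (phi psi : P (A * B)%type) :
  is_arrow alpha beta phi -> is_arrow alpha beta psi -> phi <= psi ->
  phi = psi.
Proof.
move=> hphi hpsi le; apply: le_anti; rewrite le; apply: le_at => K u v gamma h.
apply: (arrow_total hphi (arrow_dom hpsi h)) => M k w; set G := _ `&` _.
have hG : G <= reindex k gamma by exact: leIl.
have hw : G <= reindex (fun m => (u (k m), w m)) phi by exact: leIr.
have hwpsi := le_trans hw (reindex_le _ le).
apply: (arrow_sv hpsi hwpsi (reindex_at hG h)) => N l e.
rewrite !reindex_comp.
apply: (reindex_ext (u := (fun m => (u (k m), w m)) \o l)).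
  by move=> n /=; rewrite -[w (l n)]/((w \o l) n) e.
by apply: reindex_at hw.
Qed.

Definition func_pred I X (f : I -> X) (psi : P I) : P (I * X)%type :=
  tex (fun i => (i, f i)) psi.

Lemma func_intro I X (f : I -> X) (psi : P I) K (u : K -> I) gamma :
  gamma <= reindex u psi ->
  gamma <= reindex (fun m => (u m, f (u m))) (func_pred f psi).
Proof. move=> h; apply: le_trans h _; exact: tex_intro. Qed.

(** The graph only says internally that [v] is [f] of [u]; restricting along [k] turns this into an
    equality of functions, by which one can rewrite. *)
Lemma func_use I X (f : I -> X) (psi : P I) K (u : K -> I) (v : K -> X)
    gamma chi :
  gamma <= reindex (fun m => (u m, v m)) (func_pred f psi) ->
  (forall M (k : M -> K) (gamma' : P M),
     (forall m, v (k m) = f (u (k m))) ->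
     gamma' <= reindex k gamma -> gamma' <= reindex (u \o k) psi ->
     gamma' <= reindex k chi) ->
  gamma <= chi.
Proof.
move=> h1 h2; apply: tex_use h1 _ => M k i e.
have eu : u \o k = i by apply/funext => m; have [] := e m.
apply: h2; rewrite ?eu ?leIl ?leIr // => m.
by have [<- <-] := e m.
Qed.

Lemma is_arrow_func I X (f : I -> X) (psi : P I) (alpha : P X) :
  psi <= reindex f alpha -> is_arrow psi alpha (func_pred f psi).
Proof.
move=> hf; apply: is_arrowP => [K u v gamma h||K u v w gamma h1 h2].
- split; apply: (func_use h) => M k gamma' e hg hpsi; rewrite reindex_comp //.
  apply: (reindex_ext (u := f \o u \o k)) => [m|]; first by rewrite /= e.
  by have := le_trans hpsi (reindex_le _ hf); rewrite reindex_comp.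
- rewrite -[X in X <= _]reindex_id -[tex _ _]reindex_id.
  by apply: (@le_tex_fst _ _ _ _ _ id f); apply: (@func_intro _ _ _ _ _ id).
- apply: (func_use h1) => M k G e1 hG _.
  apply: (func_use (reindex_at hG h2)) => N l G' e2 _ _; rewrite !reindex_comp.
  apply: (reindex_ext (u := fun n => (f (u (k (l n))), f (u (k (l n)))))).
    by move=> n /=; rewrite e1; have /= -> := e2 n.
  exact: delta_refl.
Qed.

Lemma comp_func_intro I X D (f : I -> X) (psi : P I) (h : P (X * D)%type)
    K (u : K -> I) (v : K -> D) gamma :
  gamma <= reindex u psi ->
  gamma <= reindex (fun m => (f (u m), v m)) h ->
  gamma <= reindex (fun m => (u m, v m)) (comp_pred h (func_pred f psi)).
Proof. by move=> hu; apply: comp_intro; exact: func_intro. Qed.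

Lemma comp_func_elim I X D (f : I -> X) (psi : P I) (h : P (X * D)%type)
    K (u : K -> I) (v : K -> D) gamma :
  gamma <= reindex (fun m => (u m, v m)) (comp_pred h (func_pred f psi)) ->
  gamma <= reindex (fun m => (f (u m), v m)) h.
Proof.
move=> huv; apply: (comp_use huv) => M k w G hG h1 h2.
apply: (func_use h1) => N l G' e hG' _; rewrite !reindex_comp.
apply: (reindex_ext (u := (fun m => (w m, v (k m))) \o l)) => [n /=|].
  by rewrite e.
exact: reindex_at h2.
Qed.

Lemma comp_pred_func I X D (f : I -> X) (g : X -> D) (psi : P I) (chi : P X) :
  psi <= reindex f chi ->
  comp_pred (func_pred g chi) (func_pred f psi) = func_pred (g \o f) psi.
Proof.
(* Taking [\top] on [D] makes both sides arrows, so [arrow_le_eq] leaves a single inclusion. *)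
move=> hf; have hg : chi <= reindex g \top by rewrite reindex_top lex1.
have hgf : psi <= reindex (g \o f) \top by rewrite reindex_top lex1.
symmetry; apply: arrow_le_eq (is_arrow_func hgf) _ _.
  exact: is_arrow_comp (is_arrow_func hg) (is_arrow_func hf).
apply: le_at => K u v gamma h; apply: (func_use h) => M k G e hG hu.
rewrite reindex_comp; apply: comp_func_intro => //.
apply: (reindex_ext (u := fun m => (f (u (k m)), g (f (u (k m)))))) => [m|].
  by rewrite e.
apply: (func_intro g (u := fun m => f (u (k m)))).
by have := le_trans hu (reindex_le _ hf); rewrite reindex_comp.
Qed.

End FunctionalArrows.

(** * Surjectivity of arrows and regular epimorphisms *)

Section RegularEpimorphisms.
Context {d : Order.disp_t} {AA : implicativeAlgebra d}.
Local Notation P := (tripos AA).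

Definition func_arrow (X Y : RegP AA) (f : base X -> base Y)
    (hf : predicate X <= reindex f (predicate Y)) : hom X Y :=
  @RegArrow _ _ X Y _ (is_arrow_func hf).

(** A point [u] of [Y] has an [e]-preimage. A value of [k] at [u] is a value of [comp k e] there, so
    it is the [k']-value of some [w] that [e] also relates to this preimage, and [w] equals [u]. *)
Lemma surjective_epi (X Y Z : RegP AA) (e : hom X Y) (k k' : hom Y Z) :
  predicate Y <= tex snd (graph e) -> comp k e = comp k' e -> k = k'.
Proof.
move=> he /(congr1 (@graph _ _ _ _)) /= eq; apply: graph_inj.
apply: (arrow_le_eq (graph_arrow k) (graph_arrow k')).
apply: le_at => K u v gamma h.
have hu := arrow_dom (graph_arrow k) h.
apply: tex_use (le_trans hu (reindex_le u he)) _ => M l i ei.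
set G := _ `&` _.
have hG : G <= reindex l gamma by exact: leIl.
have hi : G <= reindex (fun m => ((i m).1, u (l m))) (graph e).
  apply: (reindex_ext (u := i)) => [m|]; last exact: leIr.
  by rewrite -ei -surjective_pairing.
have := comp_intro hi (reindex_at hG h).
rewrite eq => hk; apply: (comp_use hk) => N n w G' hG' h1 h2.
apply: (arrow_sv (graph_arrow e) (reindex_at hG' hi) h1) => L j ej.
rewrite !reindex_comp.
apply: (reindex_ext (u := (fun m => (w m, v (l (n m)))) \o j)) => [m /=|].
  by have /(congr1 (@^~ m)) /= <- := ej.
exact: reindex_at h2.
Qed.

(** Write [e] as [comp m e'] through its image. The coequalizer property turns [e'] into [k] with
    [comp k e = e'], and uniqueness gives [comp m k = idc Y], so the image contains
    [predicate Y]. *)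
Lemma regular_epi_surjective (X Y : RegP AA) (e : hom X Y) :
  regular_epi e -> predicate Y <= tex snd (graph e).
Proof.
case=> Z [u [v [euv univ]]]; set im := tex snd (graph e).
have he' : is_arrow (predicate X) im (graph e).
  case/and3P: (graph_arrow e) => _ tot sv; apply/and3P; split=> //.
  rewrite lexI; apply/andP; split.
    by case/and3P: (graph_arrow e); rewrite lexI => /andP[].
  by rewrite -tex_adj.
have him : im <= reindex id (predicate Y).
  by rewrite reindex_id tex_adj; case/and3P: (graph_arrow e);
     rewrite lexI => /andP[].
pose Im : RegP AA := RegObject im.
pose e' : hom X Im := @RegArrow _ _ X Im _ he'.
pose m : hom Im Y := @func_arrow Im Y id him.
have me' : comp m e' = e.
  (* [func_pred id im] is convertible to [id_pred im]. *)
  by apply: graph_inj; exact: (comp_pred_id_l he').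
have [|k [ke _]] := univ Im e'.
  (* [e] and [e'] have the same graph, so [e'] also equalizes [u] and [v]. *)
  by move/(congr1 (@graph _ _ _ _)): euv => euv; apply: graph_inj.
have [l [_ uniq_l]] := univ Y e euv.
have /(congr1 (@graph _ _ _ _)) /= mk : comp m k = idc Y.
  transitivity l; last by apply: uniq_l; exact: comp_idl.
  by symmetry; apply: uniq_l; rewrite -compA ke.
rewrite -[X in X <= _]reindex_id -[X in _ <= X]reindex_id.
have := @id_intro _ _ _ (predicate Y) _ id _ (lexx _).
rewrite -mk => h; apply: (comp_use h) => M n w G _ h1 h2.
apply: (func_use h2) => N j G' ej hG' hw; rewrite !reindex_comp.
by apply: (reindex_ext (u := w \o j)) hw => x; rewrite /= -ej.
Qed.

(* The coequalized pair consists of the projections of the set-theoretic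
   kernel pair of [f]; the induced arrow out of [alpha] is the image of [h]
   along [f * id]. *)
Lemma surjective_func_regular_epi (J A : SET) (f : J -> A) (psi : P J)
    (alpha : P A) (hf : psi <= reindex f alpha) : alpha <= tex f psi ->
  regular_epi (@func_arrow (RegObject psi) (RegObject alpha) f hf).
Proof.
move=> surj; set e := func_arrow _.
pose K := {p : J * J | f p.1 = f p.2}.
pose p1 (p : K) := (sval p).1; pose p2 (p : K) := (sval p).2.
pose kappa := reindex p1 psi `&` reindex p2 psi.
have h1 : kappa <= reindex p1 psi by exact: leIl.
have h2 : kappa <= reindex p2 psi by exact: leIr.
pose KK : RegP AA := RegObject kappa.
pose JJ : RegP AA := RegObject psi.
pose u : hom KK JJ := @func_arrow KK JJ p1 h1.
pose v : hom KK JJ := @func_arrow KK JJ p2 h2.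
exists KK, u, v; split.
  apply: graph_inj; rewrite /= !comp_pred_func //.
  by congr func_pred; apply/funext => p; exact: (svalP p).
move=> D h /(congr1 (@graph _ _ _ _)) /= huv.
(* [h] is constant on the fibres of [f]: the pair [(j, j')] is a point [q] of [K], and [huv] carries
   the value [w] from its first projection to its second. *)
have hconst M (j j' : M -> J) (w : M -> base D) (gamma : P M) :
    (forall m, f (j m) = f (j' m)) -> gamma <= reindex j' psi ->
    gamma <= reindex (fun m => (j m, w m)) (graph h) ->
    gamma <= reindex (fun m => (j' m, w m)) (graph h).
  move=> ej hj' hj.
  pose q m : K := exist (fun p => f p.1 = f p.2) (j m, j' m) (ej m).
  apply: (@comp_func_elim _ _ _ _ _ p2 kappa _ _ q); rewrite -huv.
  apply: comp_func_intro => //.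
  rewrite reindex_meet !reindex_comp lexI hj' andbT.
  exact: arrow_dom (graph_arrow h) hj.
pose kg : P (A * base D)%type := tex (fun p => (f p.1, p.2)) (graph h).
have kg_intro M (j : M -> J) (w : M -> base D) (gamma : P M) :
    gamma <= reindex (fun m => (j m, w m)) (graph h) ->
    gamma <= reindex (fun m => (f (j m), w m)) kg.
  by move=> hj; apply: le_trans hj _; exact: tex_intro.
have kg_use M (a : M -> A) (w : M -> base D) (gamma chi : P M) :
    gamma <= reindex (fun m => (a m, w m)) kg ->
    (forall N (l : N -> M) (j : N -> J) (gamma' : P N),
       (forall n, a (l n) = f (j n)) -> gamma' <= reindex l gamma ->
       gamma' <= reindex (fun n => (j n, w (l n))) (graph h) ->
       gamma' <= reindex l chi) ->
    gamma <= chi.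
  move=> haw hchi; apply: tex_use haw _ => N l i ei.
  apply: (hchi _ _ (fun n => (i n).1)); last 2 first.
  - exact: leIl.
  - apply: (reindex_ext (u := i)) => [n|]; last exact: leIr.
    by have [_ <-] := ei n; rewrite -surjective_pairing.
  - by move=> n; have [<-] := ei n.
have hk : is_arrow alpha (predicate D) kg.
  apply: is_arrowP => [M a w gamma haw||M a w w' gamma haw haw'].
  - split; apply: (kg_use _ _ _ _ _ haw) => N l j G ej hG hj;
      rewrite reindex_comp; last exact: arrow_cod (graph_arrow h) hj.
    apply: (reindex_ext (u := f \o j)) => [n|]; first by rewrite /= ej.
    apply: le_trans (arrow_dom (graph_arrow h) hj) _.
    by rewrite -reindex_comp; exact: reindex_le.
  - have hs : alpha <= reindex id (tex f psi) by rewrite reindex_id.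
    apply: (tex_use hs) => M k j ej; set G := _ `&` _.
    have hj : G <= reindex j psi by exact: leIr.
    apply: (arrow_total (graph_arrow h) hj) => N l w.
    rewrite !reindex_comp.
    apply: (reindex_ext (u := fun n => f (j (l n)))) => [n|].
      by rewrite ej.
    apply: (le_tex_fst (v := w)); apply: (kg_intro _ (fun n => j (l n))).
    exact: leIr.
  (* The two values come from points [j], [j'] of one fibre; [hconst] moves the first to [j'], where
     [h] is single-valued. *)
  - apply: (kg_use _ _ _ _ _ haw) => N l j G ej hG hj.
    apply: (kg_use _ _ _ _ _ (reindex_at hG haw')) => L n j' G' ej' hG' hj'.
    have hjn := reindex_at hG' hj.
    have hj'w : G' <= reindex (fun m => (j' m, w (l (n m)))) (graph h).
      apply: (hconst _ (j \o n)) => [m||//].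
        by rewrite /= -ej -ej'.
      exact: arrow_dom (graph_arrow h) hj'.
    apply: (arrow_sv (graph_arrow h) hj'w hj') => R r er; rewrite !reindex_comp.
    apply: (reindex_ext (u := fun m => (w (l (n (r m))), w (l (n (r m)))))).
      by move=> m /=; have /(congr1 (@^~ m)) /= <- := er.
    exact: delta_refl.
pose k : hom (RegObject alpha : RegP AA) D :=
  @RegArrow _ _ (RegObject alpha) D _ hk.
have ke : comp k e = h.
  symmetry; apply: graph_inj.
  apply: (arrow_le_eq (graph_arrow h) (graph_arrow (reg_comp k e))).
  apply: le_at => M j w gamma hj; apply: comp_func_intro; last exact: kg_intro.
  exact: arrow_dom (graph_arrow h) hj.
(* Uniqueness: [surj] makes [e] surjective, so [e] can be cancelled. *)
exists k; split=> // k' k'e; apply: (surjective_epi (e := e)); last by rewrite ke.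
apply: le_trans surj _; rewrite tex_adj.
rewrite -[X in X <= _]reindex_id.
apply: (le_trans (@func_intro _ _ _ _ f psi _ id _ (lexx _))).
rewrite -[X in _ <= reindex X _]/(snd \o (fun j => (j, f j))) -reindex_comp.
by apply: reindex_le; rewrite -tex_adj.
Qed.

End RegularEpimorphisms.

Theorem corollary5p33 (d : Order.disp_t) (AA : implicativeAlgebra d)
    (A : SET) (alpha : tripos AA A) :
  strongly_trackable (RegObject alpha : RegP AA) ->
  (regular_projective (RegObject alpha : RegP AA) <-> supercompact alpha).
Proof.
move=> track; split=> [proj J f psi surj | sk B C e h /regular_epi_surjective he].
  pose psi' := psi `&` reindex f alpha.
  have hf : psi' <= reindex f alpha by exact: leIr.
  have surj' : alpha <= tex f psi'.
    have surj1 : alpha <= reindex id (tex f psi) by rewrite reindex_id.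
    apply: (tex_use surj1) => M k i ei.
    apply: (reindex_ext (u := f \o i)) => [m|]; first exact: ei.
    apply: le_trans (tex_intro _ _ _); rewrite reindex_meet lexI leIr /=.
    by rewrite reindex_comp (_ : f \o i = k) ?leIl //; apply/funext => m; exact: ei.
  have [k ek] := proj _ _ _ (idc _) (surjective_func_regular_epi hf surj').
  have [g [hg _]] := track _ k.
  have hgpsi : alpha <= reindex g psi'.
    exact: arrow_cod (graph_arrow k) hg.
  exists g; first exact: le_trans hgpsi (reindex_le _ (leIl _ _)).
  have [i [_ uniq_i]] := track _ (idc (RegObject alpha : RegP AA)).
  transitivity i; last first.
    by apply: uniq_i => /=; apply: (@id_intro _ _ _ _ _ id); rewrite reindex_id.
  symmetry; apply: uniq_i.
  move: ek => /(congr1 (@graph _ _ _ _)) /= <-.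
  by apply: (comp_intro (v := g)) hg _; exact: func_intro.
have [t [ht _]] := track _ h.
have surj : alpha <= tex (@fst A (base B))
    (reindex (fun p => (p.2, t p.1)) (graph e)).
  have ht' := le_trans (arrow_cod (graph_arrow h) ht) (reindex_le t he).
  apply: (tex_use ht') => M k i ei.
  (* [(i m).1] is the preimage of [t (k m)] under [e]. *)
  pose j m := (k m, (i m).1).
  apply: (reindex_ext (u := fst \o j)) => //.
  apply: le_trans (tex_intro _ _ _); rewrite reindex_comp.
  apply: (reindex_ext (u := i)) => [m|]; last exact: leIr.
  by rewrite /= -ei -surjective_pairing.
have [g hg fg] := sk _ _ _ surj.
pose s a := (g a).2.
have hs : alpha <= reindex (fun a => (s a, t a)) (graph e).
  rewrite reindex_comp in hg; apply: reindex_ext hg => a /=.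
  by rewrite -[(g a).1]/((fst \o g) a) fg.
(* [s] induces an arrow because [e] relates [s a] to [t a] only inside [predicate B]. *)
pose k : hom (RegObject alpha : RegP AA) B :=
  @func_arrow _ _ (RegObject alpha) B s (arrow_dom (graph_arrow e) hs).
exists k; symmetry; apply: graph_inj.
apply: (arrow_le_eq (graph_arrow h) (graph_arrow (reg_comp e k))).
apply: le_at => K a c gamma hac.
have ha := arrow_dom (graph_arrow h) hac.
have hat : gamma <= reindex (fun m => (a m, t (a m))) (graph h).
  exact: reindex_at ha ht.
(* Both [c] and [t] of [a] are [h]-values at [a], so they agree, and [hs] gives the value of
   [comp e k]. *)
apply: (arrow_sv (graph_arrow h) hac hat) => M l el; rewrite reindex_comp.
have hal : reindex l gamma <= reindex (a \o l) alpha.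
  by rewrite -reindex_comp; exact: reindex_le.
apply: (comp_func_intro (u := a \o l) (v := c \o l)) => //.
apply: (reindex_ext (u := (fun x => (s x, t x)) \o (a \o l))) => [m /=|].
  by have /(congr1 (@^~ m)) /= <- := el.
exact: reindex_at hal hs.
Qed.
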